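(* Let $\mathbb K$ be a field of characteristic $0$, let $R=\mathbb K[x_1,\ldots,x_k]$, and let $\mathcal A=\{\ell_1,\ldots,\ell_n\}\subset R$, $n\ge 2$, be linear forms, no two proportional. Identify $OT(2,\mathcal A)$ with ${\bf T}/I(2,\mathcal A)$ and $OT(\mathcal A)$ with ${\bf S}/I(\mathcal A)$. Then the map $$OT(2,\mathcal A)\longrightarrow OT(\mathcal A),\qquad t_{i,j}\mapsto y_iy_j\quad(1\le i<j\le n),$$ is a well-defined embedding of ($\mathbb K$-)algebras.
   Context: The Orlik-Terao algebra of $\mathcal A$ is the subalgebra $OT(\mathcal A)=\mathbb K[1/\ell_1,\ldots,1/\ell_n]$ of the fraction field of $R$. Let ${\bf S}=\mathbb K[y_1,\ldots,y_n]$, and let $I(\mathcal A)\subset{\bf S}$ be its presentation ideal, the kernel of ${\bf S}\to OT(\mathcal A)$, $y_i\mapsto 1/\ell_i$. The Orlik-Terao algebra of the second order of $\mathcal A$ is the subalgebra $OT(2,\mathcal A)=\mathbb K[\ldots,1/(\ell_i\ell_j),\ldots]$, $1\le i<j\le n$, of the fraction field of $R$. Let ${\bf T}=\mathbb K[\ldots,t_{i,j},\ldots]$, $1\le i<j\le n$, be a polynomial ring in $\binom n2$ variables, and let $I(2,\mathcal A)\subset{\bf T}$ be its presentation ideal, the kernel of ${\bf T}\to OT(2,\mathcal A)$, $t_{i,j}\mapsto 1/(\ell_i\ell_j)$. Equivalently, $I(2,\mathcal A)$ is generated by the homogeneous $F\in{\bf T}$ with $F(\ldots,f_{i,j},\ldots)=0$,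 where $f_{i,j}=\ell_1\cdots\ell_n/(\ell_i\ell_j)$. *)

(* Defs.v *)
From HB Require Import structures.
From mathcomp Require Import all_boot all_order all_algebra.
From mathcomp Require Export mpoly.

Set Implicit Arguments.
Unset Strict Implicit.
Unset Printing Implicit Defensive.

Import GRing.Theory.
Local Open Scope ring_scope.
Local Open Scope quotient_scope.

(* MathComp makes a quotient by an ideal a commutative ring only; the          *)
(* K-algebra structure is the one inherited from the ring being divided.      *)
Section QuotientAlgebra.
Variables (K : comNzRingType) (A : comAlgType K) (I : idealr A).

Definition quot_scale (c : K) (x : {ideal_quot I}) : {ideal_quot I} :=
  \pi_{ideal_quot I} (c *: repr x).

Lemma pi_quot_scale c (a : A) :
  \pi_{ideal_quot I} (c *: a) = quot_scale c (\pi_{ideal_quot I} a).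
Proof.
rewrite /quot_scale; apply/eqP.
rewrite -Quotient.idealrBE -scalerBr -mulr_algl idealMr //.
by have /eqP := reprK (\pi_{ideal_quot I} a); rewrite eq_sym -Quotient.idealrBE.
Qed.

Fact quot_scalerA c d x : quot_scale c (quot_scale d x) = quot_scale (c * d) x.
Proof. by rewrite -[x]reprK -!pi_quot_scale scalerA reprK. Qed.

Fact quot_scale1r : left_id 1 quot_scale.
Proof. by move=> x; rewrite -[x]reprK -!pi_quot_scale scale1r. Qed.

Fact quot_scalerDr : right_distributive quot_scale +%R.
Proof.
move=> c x y; rewrite -[x]reprK -[y]reprK -!pi_quot_scale.
by rewrite -!rmorphD /= -pi_quot_scale scalerDr.
Qed.

Fact quot_scalerDl x : {morph quot_scale^~ x : c d / c + d}.
Proof.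
by move=> c d; rewrite -[x]reprK -!pi_quot_scale -rmorphD /= scalerDl.
Qed.

HB.instance Definition _ := GRing.Zmodule_isLmodule.Build K {ideal_quot I}
  quot_scalerA quot_scale1r quot_scalerDr quot_scalerDl.

Fact quot_scalerAl (c : K) (x y : {ideal_quot I}) : c *: (x * y) = c *: x * y.
Proof.
have piM (a b : A) : \pi_{ideal_quot I} (a * b) =
  \pi_{ideal_quot I} a * \pi_{ideal_quot I} b := Quotient.pi_mul I a b.
have piZ e (a : A) : \pi_{ideal_quot I} (e *: a) =
  e *: (\pi_{ideal_quot I} a : {ideal_quot I}) := pi_quot_scale e a.
by rewrite -[x]reprK -[y]reprK -piM -!piZ -piM scalerAl.
Qed.

HB.instance Definition _ :=
  GRing.Lmodule_isLalgebra.Build K {ideal_quot I} quot_scalerAl.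
HB.instance Definition _ :=
  GRing.Lalgebra_isComAlgebra.Build K {ideal_quot I}.

End QuotientAlgebra.

Section Kernel.
Variables (A : comNzRingType) (L : fieldType) (phi : {rmorphism A -> L}).

Definition kernel_pred : pred A := fun a => phi a == 0.

Fact kernel_pred_ideal : idealr_closed kernel_pred.
Proof.
split; rewrite /in_mem /= /kernel_pred ?raddf0 ?rmorph1 ?oner_neq0 //.
move=> a x y /eqP fx /eqP fy.
by rewrite /in_mem /= rmorphD rmorphM fx fy mulr0 addr0.
Qed.

HB.instance Definition _ := isIdealr.Build A kernel_pred kernel_pred_ideal.

Definition kernel : idealr A := kernel_pred.

(* First isomorphism theorem: the quotient is the image of phi inside L.      *)
Definition kernel_val (x : {ideal_quot kernel}) : L := phi (repr x).

Lemma kernel_valE a : kernel_val (\pi_{ideal_quot kernel} a) = phi a.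
Proof.
apply/eqP; rewrite -subr_eq0 -rmorphB /=.
have /eqP := reprK (\pi_{ideal_quot kernel} a).
by rewrite -Quotient.idealrBE.
Qed.

Lemma kernel_val_inj : injective kernel_val.
Proof.
move=> x y /eqP; rewrite -subr_eq0 -rmorphB => xy.
rewrite -[x]reprK -[y]reprK; apply/eqP.
by rewrite -Quotient.idealrBE.
Qed.

End Kernel.

Section OrlikTerao.
Variables (K : fieldType) (k n : nat) (ell : 'I_n -> {mpoly K[k]}).

Local Notation FracR := {fraction {mpoly K[k]}}.

Definition fracC : K -> FracR := @tofrac {mpoly K[k]} \o @mpolyC k K.
HB.instance Definition _ := GRing.RMorphism.on fracC.

(* OT and OT2 are the quotients by the kernels of the evaluations at 1/l_i    *)
(* and 1/(l_i l_j) in the fraction field; the subalgebras of FracR that they  *)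
(* stand for are the images of these evaluations (see kernel_val).            *)
Definition evalOT : {mpoly K[n]} -> FracR :=
  mmap fracC (fun i => (tofrac (ell i))^-1).
HB.instance Definition _ := GRing.RMorphism.on evalOT.

Definition OT_ideal : idealr {mpoly K[n]} := kernel evalOT.

Definition OT := {ideal_quot OT_ideal}.
HB.instance Definition _ := GRing.ComAlgebra.on OT.
HB.instance Definition _ := EqQuotient.on OT.

Definition ltpair := {p : 'I_n * 'I_n | (p.1 < p.2)%N}.

Lemma card_ltpair : #|{: ltpair}| = 'C(n, 2).
Proof.
rewrite card_sig -sum1_card -bin2_sum big_mkord.
rewrite -(pair_big_dep xpredT (fun i j : 'I_n => (i < j)%N) (fun _ _ => 1%N)).
rewrite (exchange_big_dep predT) //=; apply: eq_bigr => j _.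
by rewrite -(big_ord_widen n (fun=> 1%N) (ltnW (ltn_ord j))) sum1_card card_ord.
Qed.

(* {mpoly K[m]} has its variables indexed by 'I_m, so the variable t_(i, j)   *)
(* is numbered by the rank of (i, j) in the enumeration of the pairs i < j.   *)
Definition Tring : comAlgType K := {mpoly K[#|{: ltpair}|]}.

Definition tvar (i j : 'I_n) (ij : (i < j)%N) : Tring :=
  'X_(enum_rank (exist (fun p : 'I_n * 'I_n => (p.1 < p.2)%N) (i, j) ij)).

Definition evalOT2 : Tring -> FracR :=
  mmap fracC (fun r => let p := val (enum_val r) in
    (tofrac (ell p.1) * tofrac (ell p.2))^-1).
HB.instance Definition _ := GRing.RMorphism.on evalOT2.

Definition OT2_ideal : idealr Tring := kernel evalOT2.

Definition OT2 := {ideal_quot OT2_ideal}.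
HB.instance Definition _ := GRing.ComAlgebra.on OT2.
HB.instance Definition _ := EqQuotient.on OT2.

End OrlikTerao.

(* Main.v *)
From HB Require Import structures.
Require Import Defs.
From mathcomp Require Import all_boot all_order all_algebra.

Set Implicit Arguments.
Unset Strict Implicit.
Unset Printing Implicit Defensive.

Import GRing.Theory.
Local Open Scope ring_scope.
Local Open Scope quotient_scope.

(** The statement holds because both algebras are images inside one field:
    OT is the image of [evalOT], which sends y_i to 1/l_i, and OT2 is the image
    of [evalOT2], which sends t_(i, j) to 1/(l_i l_j).  The substitution
    t_(i, j) |-> y_i y_j followed by [evalOT] is therefore exactly [evalOT2]
    ([evalOT_tsubst]), so its pull-back of the ideal of OT is the ideal of OT2:
    one inclusion says that the substitution passes to the quotients, the other
    that the map so obtained is injective.  In other words, under the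
    identification of each quotient with its image in the field
    ([kernel_val_inj]), the map is the inclusion of one subalgebra in the other
    ([kernel_val_map]).  The passage to quotients is proved for an arbitrary
    algebra morphism between the sources of two morphisms into a field
    ([kernel_map_lrmorphism]). *)

Section KernelMap.
Variables (K : comNzRingType) (A B : comAlgType K) (L : fieldType).
Variables (phi : {rmorphism A -> L}) (chi : {rmorphism B -> L}).

Definition kernel_map (theta : A -> B) (x : {ideal_quot (kernel phi)}) :
    {ideal_quot (kernel chi)} :=
  \pi_{ideal_quot (kernel chi)} (theta (repr x)).

(** Inside the common field the induced map is an inclusion; both its
    independence of representatives and its injectivity follow from this. *)
Lemma kernel_val_map (theta : A -> B) (x : {ideal_quot (kernel phi)}) :
  chi \o theta =1 phi -> kernel_val (kernel_map theta x) = kernel_val x.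
Proof. by move=> chi_theta; rewrite kernel_valE -[LHS]/((chi \o theta) _). Qed.

Lemma kernel_map_inj (theta : A -> B) :
  chi \o theta =1 phi -> injective (kernel_map theta).
Proof.
move=> chi_theta x y xy; apply: kernel_val_inj.
by rewrite -(kernel_val_map _ chi_theta) xy kernel_val_map.
Qed.

Lemma kernel_map_pi (theta : A -> B) a :
  chi \o theta =1 phi ->
  kernel_map theta (\pi_{ideal_quot (kernel phi)} a) =
  \pi_{ideal_quot (kernel chi)} (theta a).
Proof.
move=> chi_theta; apply: kernel_val_inj.
by rewrite kernel_val_map // !kernel_valE -chi_theta.
Qed.

Lemma kernel_map_lrmorphism (theta : {lrmorphism A -> B}) :
  chi \o theta =1 phi ->
  exists psi : {lrmorphism {ideal_quot (kernel phi)} ->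
                           {ideal_quot (kernel chi)}},
    psi =1 kernel_map theta.
Proof.
move=> chi_theta; have map_pi a := kernel_map_pi a chi_theta.
have mapB : zmod_morphism (kernel_map theta).
  move=> x y; rewrite -[x]reprK -[y]reprK -rmorphB !map_pi rmorphB.
  exact: rmorphB.
have mapM : monoid_morphism (kernel_map theta).
  split=> [|x y].
    by rewrite -(rmorph1 (\pi_{ideal_quot (kernel phi)})) map_pi !rmorph1.
  rewrite -[x]reprK -[y]reprK -rmorphM !map_pi rmorphM.
  exact: rmorphM.
have mapZ : scalable (kernel_map theta).
  move=> c x; rewrite -[x]reprK.
  rewrite -[LHS]/(kernel_map theta (quot_scale c _)) -pi_quot_scale.
  rewrite !map_pi linearZ; exact: pi_quot_scale.
pose zM := GRing.isZmodMorphism.Build _ _ (kernel_map theta) mapB.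
pose mM := GRing.isMonoidMorphism.Build _ _ (kernel_map theta) mapM.
pose sM := GRing.isScalable.Build K _ _ _ (kernel_map theta) mapZ.
pose psi : {lrmorphism {ideal_quot (kernel phi)} ->
                       {ideal_quot (kernel chi)}} :=
  HB.pack (kernel_map theta) zM mM sM.
by exists psi.
Qed.

End KernelMap.

Section TSubstitution.
Variables (K : fieldType) (k n : nat) (ell : 'I_n -> {mpoly K[k]}).

Definition tsubst : {lrmorphism Tring K n -> {mpoly K[n]}} :=
  comp_mpoly [tuple let p := val (enum_val r) in 'X_(p.1) * 'X_(p.2)
             | r < #|{: ltpair n}|].

Lemma tsubst_tvar (i j : 'I_n) (ij : (i < j)%N) :
  tsubst (tvar K ij) = 'X_i * 'X_j.
Proof.
rewrite /tsubst /tvar [LHS]/(comp_mpoly _ _) /comp_mpoly mmapX mmap1U.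
by rewrite tnth_mktuple enum_rankK.
Qed.

(** Both sides are K-algebra morphisms, so it is enough to compare them on the
    variables, where the identity is the multiplicativity of the inverse. *)
Lemma evalOT_tsubst : evalOT ell \o tsubst =1 evalOT2 ell.
Proof.
move=> p; rewrite -[LHS]/(evalOT ell (comp_mpoly _ p)).
rewrite comp_mpolyEX rmorph_sum /evalOT2 /mmap; apply: eq_bigr => m _.
rewrite -mul_mpolyC rmorphM /= {1}/evalOT mmapC; congr (_ * _).
rewrite comp_mpolyX rmorph_prod; apply: eq_bigr => r _.
rewrite rmorphXn /= tnth_mktuple rmorphM /= /evalOT !mmapX !mmap1U.
by rewrite invfM.
Qed.

End TSubstitution.

Theorem proposition3p3 (K : fieldType) (charK : [pchar K] =i pred0)
    (k n : nat) (n_ge2 : (2 <= n)%N) (ell : 'I_n -> {mpoly K[k]})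
    (ell_linear : forall i, ell i \is 1.-homog)
    (ell_nonprop : forall i j, i != j -> forall c : K, ell i <> c *: ell j) :
  exists psi : {lrmorphism OT2 ell -> OT ell},
    (forall (i j : 'I_n) (ij : (i < j)%N),
       psi (\pi_(OT2 ell) (tvar K ij)) = \pi_(OT ell) ('X_i * 'X_j)) /\
    injective psi.
Proof.
have eval_subst := @evalOT_tsubst K k n ell.
have [psi psiE] := kernel_map_lrmorphism eval_subst.
exists psi; split=> [i j ij|].
  rewrite -(tsubst_tvar K ij) -[LHS]/(psi (\pi _)) psiE.
  exact: kernel_map_pi eval_subst.
exact: eq_inj (kernel_map_inj eval_subst) (fsym psiE).
Qed.
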